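(* Consider a family of discrete-time systems $x(t+1)=f_i(x(t),v(t))$, $y(t)=h_i(x(t))$, $i\in\mathcal{P}=\{1,\dots,N\}$, with index set partitioned as $\mathcal{P}=\mathcal{P}_S\sqcup\mathcal{P}_U$, a set $E(\mathcal{P})$ of admissible switches, and admissible minimum and maximum dwell times $\Delta_m$ and $\Delta_M$, subject to the standing assumptions given in the context. Suppose that $f_i(x,v)=A_ix$ with $A_i\in\mathbb{R}^{d\times d}$ and $h_i\equiv0$ for all $i\in\mathcal{P}$, and that $\Delta_m=1$. In addition, suppose that the underlying weighted directed graph $G(\mathcal{P},E(\mathcal{P}))$ of the switched system, as defined in the context, is nicely connected (with a monotone increasing function $\Phi:\mathbb{N}\to\mathbb{R}$) and nicely $\Delta$-weighted with $\Delta=1$ (and constants $\beta,B,A,\alpha$). Then a switching signal $\sigma$ obtained from the switching-signal construction described in the context (applied to a cycle obtained from the cycle detection algorithm described in the context) preserves global asymptotic stability of the switched system $x(t+1)=f_{\sigma(t)}(x(t),v(t))$, $y(t)=h_{\sigma(t)}(x(t))$ (that is, of $x(t+1)=A_{\sigma(t)}x(t)$) with probability at least $$1-\exp\left(-\frac12\left(\frac{\alpha-\beta}{A+B}\right)^2\lfloor\Phi(|\mathcal{P}_S|)\rfloor\right).$$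
   Context: **Systems.** $\mathbb{N}_0=\{0,1,2,\dots\}$; $\|\cdot\|$ is the Euclidean norm; $\lfloor y\rfloor$ is the largest integer $\le y$; $[\Delta_m:\Delta_M]$ is the set of integers from $\Delta_m$ to $\Delta_M$, where $\Delta_m$ and $\Delta_M$ are the admissible minimum and maximum dwell times on each subsystem. The family of systems is $x(t+1)=f_i(x(t),v(t))$, $x(0)=x_0$, $y(t)=h_i(x(t))$, $t\in\mathbb{N}_0$, $i\in\mathcal{P}=\{1,\dots,N\}$, with $x(t)\in\mathbb{R}^d$, $v(t)\in\mathbb{R}^m$, $y(t)\in\mathbb{R}^p$ the states, inputs and outputs, and $\ker f_i(\cdot,0)=\{0\}$ for each $i$. A switching signal $\sigma:\mathbb{N}_0\to\mathcal{P}$ generates the switched system $x(t+1)=f_{\sigma(t)}(x(t),v(t))$, $y(t)=h_{\sigma(t)}(x(t))$. $\mathcal{P}_S$ and $\mathcal{P}_U$ are the sets of indices of the input/output-to-state stable (IOSS) and the unstable subsystems, $\mathcal{P}=\mathcal{P}_S\sqcup\mathcal{P}_U$. $E(\mathcal{P})$ is the set of ordered pairs $(i,j)$, $i,j\in\mathcal{P}$, $i\ne j$, such that a switch from subsystem $i$ to subsystem $j$ is admissible. **Stability.** The switched system is IOSS for $\sigma$ if there exist $\chi_1\in\mathcal{KL}$ and $\chi_2,\chi_3\in\mathcal{K}$ such that for all bounded inputs $v$ and all $x(0)\in\mathbb{R}^d$, $\|x(t)\|\le\chi_1(\|x(0)\|,t)+\chi_2(\|v\|_t)+\chi_3(\|y\|_t)$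 for all $t\in\mathbb{N}_0$, where $\|w\|_t:=\sup\{\|w(s)\|:s\in\mathbb{N}_0,s\le t\}$. Global asymptotic stability (GAS) is the case $\chi_3\equiv0$, $v\equiv0$: there is $\chi_1\in\mathcal{KL}$ with $\|x(t)\|\le\chi_1(\|x(0)\|,t)$ for all $x(0)\in\mathbb{R}^d$ and $t\in\mathbb{N}_0$. ''$\sigma$ preserves GAS'' means that the switched system is GAS under $\sigma$. **Standing Lyapunov assumptions.** For each $i\in\mathcal{P}$ there are continuous functions $V_i:\mathbb{R}^d\to[0,+\infty[$, class $\mathcal{K}_\infty$ functions $\underline\alpha,\overline\alpha$, class $\mathcal{K}$ functions $\gamma_1,\gamma_2$, and scalars $\lambda_i$ with $0<\lambda_i<1$ for $i\in\mathcal{P}_S$ and $\lambda_i>1$ for $i\in\mathcal{P}_U$, such that for all $\xi\in\mathbb{R}^d$, $\eta\in\mathbb{R}^m$: $\underline\alpha(\|\xi\|)\le V_i(\xi)\le\overline\alpha(\|\xi\|)$ and $V_i(f_i(\xi,\eta))\le\lambda_iV_i(\xi)+\gamma_1(\|\eta\|)+\gamma_2(\|h_i(\xi)\|)$. For each $(i,j)\in E(\mathcal{P})$ there is $\mu_{ij}\ge1$ with $V_j(\xi)\le\mu_{ij}V_i(\xi)$ for all $\xi\in\mathbb{R}^d$. **Underlying weighted directed graph $G(\mathcal{P},E(\mathcal{P}))$.** Vertex set $\mathcal{P}$, directed edge set $E(\mathcal{P})$; vertex weights $w(j)=-|\ln\lambda_j|$ for $j\in\mathcal{P}_S$ and $w(j)=|\ln\lambda_j|$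 for $j\in\mathcal{P}_U$; edge weights $w(i,j)=\ln\mu_{ij}$ for $(i,j)\in E(\mathcal{P})$. The weights are treated as random variables; the sets $\mathcal{P}_S,\mathcal{P}_U,E(\mathcal{P})$ are deterministic. A cycle is a closed walk $v_0,(v_0,v_1),v_1,\dots,v_{n-1},(v_{n-1},v_0),v_0$ with $v_0,\dots,v_{n-1}$ distinct and all edges in $E(\mathcal{P})$; its length is $n$. **Nicely connected.** For $v\in\mathcal{P}$ let $N^+_{\mathcal{P}_S}(v)=\{u\in\mathcal{P}_S:(v,u)\in E(\mathcal{P})\}$ and $d^+_{\mathcal{P}_S}(v)=|N^+_{\mathcal{P}_S}(v)|$. Given a monotone increasing $\Phi:\mathbb{N}\to\mathbb{R}$, the graph is nicely connected if $d^+_{\mathcal{P}_S}(j)\ge\lfloor\Phi(|\mathcal{P}_S|)\rfloor$ for all $j\in\mathcal{P}$. **Nicely $\Delta$-weighted.** The graph is nicely $\Delta$-weighted if: (1) there exist $\Delta\in[\Delta_m:\Delta_M]$ and $0<\beta<B$ such that $0<|w(j)|\Delta\le B$ and $\mathrm{E}\big[|w(j)|\Delta\,\big|\,\{|w(\ell)|\Delta\}_{\ell\ne j},\{w(k,\ell)\}_{(k,\ell)\in E(\mathcal{P})}\big]=\beta$ for all $j\in\mathcal{P}$; and (2) there exist constants $A>0$ and $\alpha<\beta$ such that for every $(i,j)\in E(\mathcal{P})$, $w(i,j)\in[-A,A]$ and $\mathrm{E}\big[w(i,j)\,\big|\,\{|w(\ell)|\Delta\}_{\ell\in\mathcal{P}},\{w(k,\ell)\}_{(k,\ell)\ne(i,j)}\big]\le\alpha$.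 ''With $\Delta=1$'' means that these conditions hold with the choice $\Delta=1$. **Cycle detection algorithm.** Pick $v_0\in\mathcal{P}_S$ uniformly at random; set $k=0$. While $N^+_{\mathcal{P}_S}(v_k)\setminus\{v_0,\dots,v_k\}\ne\emptyset$, pick $v_{k+1}$ in this set uniformly at random and increase $k$ by 1. When this set is empty, pick $v_{k+1}=v_i$ with $v_i\in N^+_{\mathcal{P}_S}(v_k)$ and $k-i$ maximum, and stop. The cycle obtained is $v_i,v_{i+1},\dots,v_k,v_i$ (relabelled to start at $v_0$). The random choices of the algorithm are made independently of the weights. **Switching-signal construction.** Given a cycle $v_0,(v_0,v_1),v_1,\dots,v_{n-1},(v_{n-1},v_0),v_0$ obtained from the cycle detection algorithm and the $\Delta$ of the nicely $\Delta$-weighted property (here $\Delta=1$), set $\tau_0=0$ and, for $k=0,1,2,\dots$ and $p=kn,kn+1,\dots,(k+1)n-1$, set $\sigma(\tau_p)=v_{p-kn}$ and $\tau_{p+1}=\tau_p+\Delta$; $\sigma$ is constant on $[\tau_p,\tau_{p+1})\cap\mathbb{N}_0$. *)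

(* Defs.v *)
From HB Require Import structures.
From mathcomp Require Import all_boot all_order all_algebra.
From mathcomp Require Import all_classical all_reals all_analysis.

Set Implicit Arguments.
Unset Strict Implicit.
Unset Printing Implicit Defensive.

Import Order.TTheory GRing.Theory Num.Theory.
Import numFieldNormedType.Exports.

Local Open Scope classical_set_scope.
Local Open Scope ring_scope.

Section comparison_functions.
Variable R : realType.
Implicit Types (a : R -> R) (chi : R -> R -> R).

(* Comparison functions live on [0, +oo[: they are encoded as functions on R
   whose values at negative arguments are irrelevant.  Nonnegativity of the
   values follows from monotonicity and a 0 = 0. *)
Definition class_K a : Prop :=
  [/\ {within `[0, +oo[, continuous a},
      forall r s : R, 0 <= r -> r < s -> a r < a s
    & a 0 = 0].

Definition class_Kinfty a : Prop :=
  class_K a /\ a r @[r --> +oo] --> +oo.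

Definition class_KL chi : Prop :=
  (forall t : R, 0 <= t -> class_K (chi ^~ t)) /\
  (forall r : R, 0 <= r ->
    (forall s t : R, 0 <= s -> s <= t -> chi r t <= chi r s) /\
    chi r t @[t --> +oo] --> (0 : R)).

End comparison_functions.

Section switched_systems.
Variables (R : realType) (N d m p : nat).
Implicit Types (f : 'I_N -> 'cV[R]_d -> 'cV[R]_m -> 'cV[R]_d).
Implicit Types (h : 'I_N -> 'cV[R]_d -> 'cV[R]_p).
Implicit Types (sigma : nat -> 'I_N).

(* The library norm on matrices is the sup norm, hence this definition. *)
Definition enorm n (x : 'cV[R]_n) : R := Num.sqrt (\sum_(i < n) x i 0 ^+ 2).

Definition sup_enorm n (w : nat -> 'cV[R]_n) (t : nat) : R :=
  sup [set enorm (w s) | s in [set s : nat | (s <= t)%N]].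

Fixpoint trajectory f sigma (v : nat -> 'cV[R]_m) (x0 : 'cV[R]_d) (t : nat)
    : 'cV[R]_d :=
  if t is t'.+1
  then f (sigma t') (trajectory f sigma v x0 t') (v t')
  else x0.

Definition output f h sigma v x0 (t : nat) : 'cV[R]_p :=
  h (sigma t) (trajectory f sigma v x0 t).

Definition IOSS f h sigma : Prop :=
  exists (chi1 : R -> R -> R) (chi2 chi3 : R -> R),
    [/\ class_KL chi1, class_K chi2, class_K chi3
      & forall v : nat -> 'cV[R]_m,
        (exists M : R, forall t, enorm (v t) <= M) ->
        forall (x0 : 'cV[R]_d) (t : nat),
          enorm (trajectory f sigma v x0 t)
          <= chi1 (enorm x0) t%:R + chi2 (sup_enorm v t)
             + chi3 (sup_enorm (output f h sigma v x0) t)].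

Definition GAS f sigma : Prop :=
  exists chi1 : R -> R -> R, class_KL chi1 /\
    forall (x0 : 'cV[R]_d) (t : nat),
      enorm (trajectory f sigma (fun=> 0) x0 t) <= chi1 (enorm x0) t%:R.

Definition lyapunov_assumptions f h (PS : {set 'I_N}) (E : {set 'I_N * 'I_N})
    (lam : 'I_N -> R) (mu : 'I_N -> 'I_N -> R) : Prop :=
  exists (V : 'I_N -> 'cV[R]_d -> R) (al au g1 g2 : R -> R),
  [/\ [/\ class_Kinfty al, class_Kinfty au, class_K g1 & class_K g2],
      forall i, continuous (V i) /\ (forall xi, 0 <= V i xi),
      forall i, (i \in PS -> 0 < lam i < 1) /\ (i \notin PS -> 1 < lam i),
      forall i xi eta, al (enorm xi) <= V i xi <= au (enorm xi) /\
        V i (f i xi eta)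
        <= lam i * V i xi + g1 (enorm eta) + g2 (enorm (h i xi))
    & forall i j, (i, j) \in E ->
        1 <= mu i j /\ (forall xi, V j xi <= mu i j * V i xi)].

End switched_systems.

Section cycle_detection.
Variables (R : realType) (N : nat).
Variables (PS : {set 'I_N}) (E : {set 'I_N * 'I_N}).

Definition Nplus (v : 'I_N) : {set 'I_N} := [set u in PS | (v, u) \in E].

Definition monotone_increasing (Phi : nat -> R) : Prop :=
  forall k l : nat, (0 < k)%N -> (k <= l)%N -> Phi k <= Phi l.

Definition nicely_connected (Phi : nat -> R) : Prop :=
  forall j : 'I_N, Num.floor (Phi #|PS|) <= #|Nplus j|%:Z.

(* Probability that the algorithm, currently at v after having visited the
   vertices in vis (which contains v), continues exactly along s and then
   finds no unvisited out-neighbour. *)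
Fixpoint walk_prob (vis : seq 'I_N) (v : 'I_N) (s : seq 'I_N) : R :=
  let C := [set u in Nplus v | u \notin vis] in
  if s is u :: s'
  then if u \in C then #|C|%:R^-1 * walk_prob (u :: vis) u s' else 0
  else (C == finset.set0)%:R.

(* Probability that the walk v_0, ..., v_k produced by the algorithm, up to
   the vertex v_k whose out-neighbours in PS have all been visited, is s. *)
Definition run_prob (s : seq 'I_N) : R :=
  if s is v :: s'
  then if v \in PS then #|PS|%:R^-1 * walk_prob [:: v] v s' else 0
  else 0.

(* Cycle v_i, ..., v_k extracted from the walk v_0, ..., v_k: k - i is maximum
   when v_i is the first vertex of the walk lying in Nplus v_k.  The closing
   occurrence of v_i is not repeated, so the size is the length of the cycle;
   the result is empty exactly when there is no vertex v_i to pick. *)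
Definition cycle_of_run (s : seq 'I_N) : seq 'I_N :=
  if s is v :: s'
  then drop (find (fun u => u \in Nplus (last v s')) s) s
  else [::].

(* c = [:: v_0; ...; v_(n-1)]. *)
Definition switching_construction (Delta : nat) (c : seq 'I_N)
    (sigma : nat -> 'I_N) : Prop :=
  let n := size c in
  exists tau : nat -> nat, tau 0%N = 0%N /\
    forall k q : nat, (k * n <= q < k.+1 * n)%N ->
      [/\ Some (sigma (tau q)) = onth c (q - k * n),
          tau q.+1 = (tau q + Delta)%N
        & forall t, (tau q <= t < tau q.+1)%N -> sigma t = sigma (tau q)].

End cycle_detection.

Section random_weights.
Context {R : realType} {d : measure_display} {T : measurableType d}.
Variable P : probability T R.

Definition sigma_of (F : set (T -> R)) : set (set T) :=
  <<s [set X @^-1` B | X in F & B in measurable] >>.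

(* Y is a version of the conditional expectation of X given G. *)
Definition is_cond_exp (G : set (set T)) (X Y : T -> R) : Prop :=
  [/\ P.-integrable setT (EFin \o Y),
      forall B : set R, measurable B -> G (Y @^-1` B)
    & forall B : set T, G B ->
        (\int[P]_(w in B) (Y w)%:E = \int[P]_(w in B) (X w)%:E)%E].

Definition vweight N (PS : {set 'I_N}) (lam : 'I_N -> T -> R) (j : 'I_N)
    (w : T) : R :=
  if j \in PS then - `|ln (lam j w)| else `|ln (lam j w)|.

Definition eweight N (mu : 'I_N -> 'I_N -> T -> R) (e : 'I_N * 'I_N) (w : T)
    : R := ln (mu e.1 e.2 w).

Section weighted_graph.
Variables (N : nat) (E : {set 'I_N * 'I_N}).
Variables (wv : 'I_N -> T -> R) (we : 'I_N * 'I_N -> T -> R).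

Definition abs_scaled (Delta : nat) (j : 'I_N) (w : T) : R :=
  `|wv j w| * Delta%:R.

(* Bounds and conditional expectations are understood almost surely. *)
Definition nicely_weighted_with (Dm DM Delta : nat) (beta B A alpha : R)
    : Prop :=
  [/\ (Dm <= Delta <= DM)%N,
      0 < beta < B /\
      (forall j,
        {ae P, forall w, 0 < abs_scaled Delta j w <= B} /\
        (exists Y, is_cond_exp
           (sigma_of ([set abs_scaled Delta l | l in [set l | l != j]]
                      `|` [set we e | e in [set e | e \in E]]))
           (abs_scaled Delta j) Y
           /\ {ae P, forall w, Y w = beta})),
      0 < A /\ alpha < beta
    & forall e, e \in E ->
        {ae P, forall w, - A <= we e w <= A} /\
        (exists Y, is_cond_exp
           (sigma_of (range (abs_scaled Delta)
                      `|` [set we e' | e' in [set e' | e' \in E /\ e' != e]]))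
           (we e) Y
           /\ {ae P, forall w, Y w <= alpha})].

Definition sigma_weights : set (set T) :=
  sigma_of (range wv `|` [set we e | e in [set e | e \in E]]).

(* run is the random walk of the cycle detection algorithm: it has the law
   prescribed by the algorithm and is independent of the weights. *)
Definition cycle_detection_run (PS : {set 'I_N}) (run : T -> seq 'I_N)
    : Prop :=
  forall s : seq 'I_N,
    [/\ measurable [set w | run w = s],
        P [set w | run w = s] = (run_prob R PS E s)%:E
      & forall B : set T, sigma_weights B ->
          (P ([set w | run w = s] `&` B) = P [set w | run w = s] * P B)%E].

End weighted_graph.

(* No measurability of S is presupposed: S contains an event of probability
   at least r (for a measurable S this says r <= P S). *)
Definition holds_with_prob_at_least (S : set T) (r : R) : Prop :=
  exists F : set T, [/\ measurable F, F `<=` S & (r%:E <= P F)%E].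

End random_weights.

(* Main.v *)
(* The weight S of the cycle, the sum over its vertices v of the edge weight
   minus |ln lambda_v|, is the logarithm of the factor by which the Lyapunov
   functions shrink over one period of sigma; so S < 0 forces every trajectory
   to 0, and by linearity the decay is uniform in the initial state, which is
   GAS.  All >= floor(Phi) out-neighbours in P_S of the last vertex of the walk
   lie on the cycle, so its length n is at least floor(Phi).

   Tail of S: write S = sum_k D_k with |D_k| <= C := A + B.  Given all the other
   terms, D_k has conditional mean at most -delta := alpha - beta.  With
   e = delta / C, a Chernoff bound tilted at tanh u = e gives
   1_(S >= 0) <= (1 - e^2)^(-n/2) * prod_k (1 + e D_k / C), and since the factors
   are affine in D_k the expectation of the product is at most (1 - e^2)^n by
   removing one factor at a time.  Hence P(S >= 0) <= (1 - e^2)^(n/2)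
   <= exp(- e^2 n / 2).  The walk is independent of the weights, so one may
   condition on it. *)

Require Import Defs.
From HB Require Import structures.
From mathcomp Require Import all_boot all_order all_algebra.
From mathcomp Require Import all_classical all_reals all_analysis.
From mathcomp Require Import measurable_realfun unstable ring lra.

Import Order.TTheory GRing.Theory Num.Theory.
Import numFieldNormedType.Exports.

Local Open Scope classical_set_scope.
Local Open Scope ring_scope.

Set Implicit Arguments.
Unset Strict Implicit.

(** * Deterministic stability *)

Lemma cvg_sum0 {R : realType} (n : nat) (u : 'I_n -> nat -> R) :
  (forall i, u i t @[t --> \oo] --> 0) ->
  (\sum_i u i t) @[t --> \oo] --> 0.
Proof.
move=> u0; have := @cvg_big _ _ +%R 0 xpredT add_continuous _ \oo
  (index_enum 'I_n) u (fun=> 0 : R) _ (fun i _ => u0 i).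
by rewrite big1 //; apply.
Qed.

(** * Euclidean norm against the entries of a vector *)

Section euclidean_norm.
Context {R : realType} {n : nat}.
Implicit Types x : 'cV[R]_n.

Lemma enorm_ge0 x : 0 <= enorm x.
Proof. exact: sqrtr_ge0. Qed.

Lemma enorm0 : enorm (0 : 'cV[R]_n) = 0.
Proof.
by rewrite /enorm big1 ?sqrtr0// => i _; rewrite mxE expr0n.
Qed.

Lemma normr_le_enorm x i : `|x i 0| <= enorm x.
Proof.
rewrite /enorm -sqrtr_sqr ler_sqrt; last by apply: sumr_ge0 => j _; exact: sqr_ge0.
by rewrite (bigD1 i)//= lerDl; apply: sumr_ge0 => j _; exact: sqr_ge0.
Qed.

Lemma enorm_le_sum_normr x : enorm x <= \sum_i `|x i 0|.
Proof.
have s0 (r : seq 'I_n) : 0 <= \sum_(i <- r) `|x i 0| by exact: sumr_ge0.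
rewrite /enorm -[leRHS]ger0_norm// -sqrtr_sqr ler_sqrt ?sqr_ge0//.
elim: (index_enum _) => [|i r IH]; first by rewrite !big_nil expr0n.
rewrite !big_cons sqrrD real_normK ?num_real// -addrA lerD2l.
by apply: le_trans IH _; rewrite lerDr mulrn_wge0// mulr_ge0.
Qed.

Lemma enorm_cvg0 (u : nat -> 'cV[R]_n) :
  (enorm (u t) @[t --> \oo] --> 0) ->
  (\sum_i `|u t i 0|) @[t --> \oo] --> 0.
Proof.
move=> u0.
apply: cvg_sum0 => i; apply: (@squeeze_cvgr _ _ _ _ (fun=> 0) (fun t => enorm (u t))) => //.
- by near=> t; rewrite normr_ge0 normr_le_enorm.
- exact: cvg_cst.
Unshelve. all: by end_near. Qed.

End euclidean_norm.

(** * From pointwise to uniform decay for linear switched systems *)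

Section linear_decay.
Context {R : realType}.

(* [g] is replaced by its decreasing majorant sup_(s >= t) g s; the term
   expR (- t) makes the coefficient positive, as class_K demands strict
   monotonicity. *)
Lemma exists_class_KL (g : nat -> R) :
  (forall t, 0 <= g t) -> g t @[t --> \oo] --> 0 ->
  exists chi : R -> R -> R, class_KL chi /\
    forall r t, 0 <= r -> r * g t <= chi r t%:R.
Proof.
move=> g0 gcvg.
pose S (t : R) := [set g s | s in [set s : nat | t <= s%:R]].
have [t1 ht1] : exists t1, forall t, (t1 <= t)%N -> g t < 1.
  have /cvgrPdist_lt/(_ 1 ltr01)[t1 _ h] := gcvg; exists t1 => t /h /=.
  by rewrite sub0r normrN ger0_norm.
(* From [t1] on the values are below 1; the finitely many earlier ones are bounded by their sum. *)
have Sub t : has_ubound (S t).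
  exists (1 + \sum_(s < t1) g s) => _ [s _ <-].
  have [lt|le] := ltnP s t1; last first.
    by apply: le_trans (ltW (ht1 _ le)) _; rewrite lerDl sumr_ge0.
  rewrite (bigD1 (Ordinal lt))//= addrCA lerDl addr_ge0 ?ler01//.
  exact: sumr_ge0.
have S0 t : S t !=set0.
  exists (g (Num.bound t)), (Num.bound t) => //=.
  exact/ltW/ltr_bound.
have sup0 t : 0 <= sup (S t).
  by have [_ [s st _]] := S0 t; apply: le_trans (g0 s) _; apply: ub_le_sup => //; exists s.
pose k t := sup (S t) + expR (- t).
have k0 t : 0 < k t by rewrite ltr_wpDl ?expR_gt0.
exists (fun r t => r * k t); split; last first.
  move=> r t r0; rewrite ler_wpM2l// ler_wpDr ?expR_ge0//.
  by apply: ub_le_sup => //; exists t => /=.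
split=> [t t0|r r0].
  split.
  - by apply: continuous_subspaceT => x; apply: mulrr_continuous.
  - by move=> x y x0 xy; rewrite ltr_pM2r.
  - by rewrite mul0r.
split=> [s t s0 st|].
  rewrite ler_wpM2l// lerD//; last by rewrite ler_expR lerN2.
  apply: ge_sup => // _ [u tu <-]; apply: ub_le_sup => //; exists u => //=.
  exact: le_trans tu.
rewrite -[X in _ --> X](mulr0 r); apply: cvgMr.
rewrite -[X in _ --> X](addr0 0); apply: cvgD; last exact: cvgr_expR.
apply/cvgrPdist_lt => e e0.
have e20 : 0 < e / 2 by rewrite divr_gt0.
have /cvgrPdist_lt/(_ _ e20)[t2 _ h] := gcvg.
near=> t; rewrite sub0r normrN ger0_norm//.
apply: (@le_lt_trans _ _ (e / 2)); last by lra.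
apply: ge_sup => // _ [s /= ts <-].
have /h /= : (t2 <= s)%N.
  rewrite -(ler_nat R); apply: le_trans ts.
  by near: t; apply: nbhs_pinfty_ge; exact: num_real.
by rewrite sub0r normrN ger0_norm// => /ltW.
Unshelve. all: by end_near. Qed.

Context {N d m : nat}.
Variables (f : 'I_N -> 'cV[R]_d -> 'cV[R]_m -> 'cV[R]_d) (sigma : nat -> 'I_N).
Variable A : 'I_N -> 'M[R]_d.
Hypothesis flin : forall i xi eta, f i xi eta = A i *m xi.

Lemma trajectory_linear v x0 t : trajectory f sigma v x0 t =
  iteri t (fun k M => A (sigma k) *m M) 1%:M *m x0.
Proof.
by elim: t => [|t IH] /=; rewrite ?mul1mx// flin IH mulmxA.
Qed.

(** The state at time [t] is a matrix applied to [x0], and the columns of that matrix are the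
    trajectories from the basis vectors. The sum [g t] of its absolute entries is thus a finite sum
    of null sequences, and it bounds the growth for every [x0] at once. *)
Lemma linear_GAS :
  (forall x0, enorm (trajectory f sigma (fun=> 0) x0 t) @[t --> \oo] --> 0) ->
  GAS f sigma.
Proof.
move=> x_cvg.
pose e i := delta_mx i 0 : 'cV[R]_d.
pose g t := \sum_i \sum_j `|trajectory f sigma (fun=> 0) (e i) t j 0|.
have g0 t : 0 <= g t by apply: sumr_ge0 => i _; apply: sumr_ge0.
have gcvg : g t @[t --> \oo] --> 0.
  by apply: cvg_sum0 => i; apply: enorm_cvg0; exact: x_cvg.
have [chi [KLchi hchi]] := exists_class_KL g0 gcvg.
exists chi; split=> // x0 t; apply: le_trans (hchi _ t (enorm_ge0 x0)).
apply: le_trans (enorm_le_sum_normr _) _.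
rewrite /g exchange_big mulr_sumr; apply: ler_sum => j _.
rewrite trajectory_linear; set M := iteri _ _ _.
rewrite mxE mulr_sumr; apply: le_trans (ler_norm_sum _ _ _) _.
apply: ler_sum => i _; rewrite trajectory_linear -/M normrM mulrC.
rewrite ler_pM ?normr_ge0 ?normr_le_enorm//.
rewrite (_ : (M *m e i) j 0 = M j i)// mxE (bigD1 i)//= big1 => [|k ki].
  by rewrite addr0 mxE !eqxx mulr1.
by rewrite mxE (negbTE ki) mulr0.
Qed.

End linear_decay.

(** * Periodic switching signals and products along them *)

Section periodic_switching.
Context {R : realType} {N : nat}.
Variables (sigma : nat -> 'I_N) (c : seq 'I_N).
Hypothesis c0 : (0 < size c)%N.

(** Unit dwell time makes every instant a switching instant, [tau q = q]; time [q] then lies in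
    block [q %/ size c], at offset [q %% size c]. *)
Lemma switching_construction_periodic : switching_construction 1 c sigma ->
  forall v t, sigma t = nth v c (t %% size c).
Proof.
move=> [tau [tau0 h]] v.
have blk q : (q %/ size c * size c <= q < (q %/ size c).+1 * size c)%N.
  by rewrite leq_divM ltn_ceil.
have tauE q : tau q = q.
  by elim: q => [//|q IH]; have [_ -> _] := h _ _ (blk q); rewrite IH addn1.
move=> t; have [+ _ _] := h _ _ (blk t); rewrite tauE.
have -> : (t - t %/ size c * size c = t %% size c)%N.
  by rewrite {1}(divn_eq t (size c)) addKn.
by move=> /esym/(onth_nth v) ->.
Qed.

Hypothesis uc : uniq c.
Hypothesis sigmaE : forall v t, sigma t = nth v c (t %% size c).

Lemma periodic_mem t : sigma t \in c.
Proof. by rewrite (sigmaE (sigma t)) mem_nth// ltn_pmod. Qed.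

Lemma periodic_next t : sigma t.+1 = next c (sigma t).
Proof.
rewrite next_nth periodic_mem.
have hi : index (sigma t) c = (t %% size c)%N.
  by rewrite (sigmaE (sigma t)) index_uniq// ltn_pmod.
rewrite hi (sigmaE (sigma t) t.+1) -addn1 -modnDml addn1.
have := ltn_pmod t c0; set k := (t %% size c)%N.
case: (c) => [//|y r /= lt].
(* [next] reads the tail [r] with default value [y]: at the last position it overflows to the head,
   which is the wrap-around of the modulus. *)
move: lt; rewrite ltnS leq_eqVlt => /predU1P[->|lt].
  by rewrite modnn /= nth_default.
by rewrite modn_small//=; apply: set_nth_default.
Qed.

Variable F : 'I_N -> R.

Lemma periodic_prod_period : \prod_(l < size c) F (sigma l) = \prod_(v <- c) F v.
Proof.
have v : 'I_N := sigma 0.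
rewrite (big_nth v) big_mkord; apply: eq_bigr => l _.
by rewrite (sigmaE v) modn_small.
Qed.

Lemma periodic_prod k r : \prod_(l < k * size c + r) F (sigma l) =
  (\prod_(v <- c) F v) ^+ k * \prod_(l < r) F (sigma l).
Proof.
have v : 'I_N := sigma 0.
elim: k => [|k IH]; first by rewrite mul0n add0n mul1r.
rewrite mulSn -addnA big_split_ord /= periodic_prod_period exprS -mulrA -IH.
congr (_ * _); apply: eq_bigr => l _; congr F.
by rewrite (sigmaE v) modnDl -(sigmaE v).
Qed.

(** Splitting [t] into full periods and a remainder, the product is a power of the one-period
    factor, which is below 1, times a partial product shorter than a period. *)
Lemma periodic_prod_cvg0 : (forall v, v \in c -> 0 < F v) ->
  \prod_(v <- c) F v < 1 ->
  (\prod_(l < t) F (sigma l)) @[t --> \oo] --> 0.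
Proof.
move=> F0 q1; set q := \prod_(v <- c) F v in q1 *.
have W0 t : 0 < \prod_(l < t) F (sigma l).
  by apply: prodr_gt0 => l _; apply: F0; exact: periodic_mem.
have q0 : 0 < q by rewrite /q -periodic_prod_period.
(* A bound for all these partial products at once: each is one term of this sum of positive
   terms. *)
pose K := \sum_(r < size c) \prod_(l < r) F (sigma l).
have K0 : 0 < K.
  rewrite /K (bigD1 (Ordinal c0))//= ltr_wpDr ?W0//.
  by apply: sumr_ge0 => r _; exact: (ltW (W0 r)).
have q1' : `|q| < 1 by rewrite gtr0_norm.
apply/cvgrPdist_lt => e e0.
have /cvgrPdist_lt/(_ _ (divr_gt0 e0 K0))[k0 _ hk] := cvg_expr q1'.
near=> t; rewrite sub0r normrN gtr0_norm//.
have := hk (t %/ size c)%N; rewrite /= sub0r normrN gtr0_norm ?exprn_gt0//.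
have kt : (k0 <= t %/ size c)%N.
  rewrite leq_divRL//; near: t; exact: nbhs_infty_ge.
move=> /(_ kt); rewrite ltr_pdivlMr// => h; apply: le_lt_trans h.
rewrite [in leLHS](divn_eq t (size c)) periodic_prod ler_pM2l ?exprn_gt0//.
rewrite /K (bigD1 (Ordinal (ltn_pmod t c0)))//= lerDl.
by apply: sumr_ge0 => r _; exact: (ltW (W0 r)).
Unshelve. all: by end_near. Qed.

End periodic_switching.

(** * Lyapunov decay along a switched trajectory *)

Section lyapunov_decay.
Context {R : realType} {N d m p : nat}.
Variables (f : 'I_N -> 'cV[R]_d -> 'cV[R]_m -> 'cV[R]_d).
Variables (h : 'I_N -> 'cV[R]_d -> 'cV[R]_p).
Variables (PS : {set 'I_N}) (E : {set 'I_N * 'I_N}).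
Variables (lam : 'I_N -> R) (mu : 'I_N -> 'I_N -> R) (sigma : nat -> 'I_N).
Hypothesis (hlyap : lyapunov_assumptions f h PS E lam mu).
Hypothesis (hout : forall i xi, h i xi = 0).
Hypothesis (sigmaE : forall t, (sigma t, sigma t.+1) \in E).

(** Every time step is treated as a switch: the one-step estimate followed by the comparison along
    the edge multiplies the current Lyapunov value by at most [lam * mu]. The gain terms vanish
    because input and output are zero, and the lower bound [al] carries the decay over to the
    norm. *)
Lemma lyapunov_trajectory_cvg0 :
  (\prod_(l < t) (lam (sigma l) * mu (sigma l) (sigma l.+1)))
    @[t --> \oo] --> 0 ->
  forall x0, enorm (trajectory f sigma (fun=> 0) x0 t) @[t --> \oo] --> 0.
Proof.
move=> Wcvg x0; have [V [al [au [g1 [g2 [[Kal _ Kg1 Kg2]]]]]]] := hlyap.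
move=> hV hlam hdec hmu.
pose x := trajectory f sigma (fun=> 0) x0.
have lam0 i : 0 < lam i.
  have [hs hu] := hlam i; have [/hs/andP[]//|/hu] := boolP (i \in PS).
  exact: lt_trans.
have V0 i xi : 0 <= V i xi by apply: (hV i).2.
have step t : V (sigma t.+1) (x t.+1) <=
    lam (sigma t) * mu (sigma t) (sigma t.+1) * V (sigma t) (x t).
  have [mu1 hm] := hmu _ _ (sigmaE t).
  apply: le_trans (hm _) _; rewrite [lam _ * _]mulrC -mulrA.
  rewrite ler_wpM2l ?(le_trans ler01)//.
  have [_] := hdec (sigma t) (x t) 0.
  have [_ _ g10] := Kg1; have [_ _ g20] := Kg2.
  by rewrite hout !enorm0 g10 g20 !addr0.
have bound t : V (sigma t) (x t) <=
    (\prod_(l < t) (lam (sigma l) * mu (sigma l) (sigma l.+1))) *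
    V (sigma 0%N) x0.
  elim: t => [|t IH]; first by rewrite big_ord0 mul1r.
  rewrite big_ord_recr /= mulrAC [X in _ <= X]mulrC.
  apply: le_trans (step t) _; rewrite ler_wpM2l// mulr_ge0 ?(ltW (lam0 _))//.
  by have [mu1 _] := hmu _ _ (sigmaE t); exact: le_trans mu1.
have [[_ al_incr _] _] := Kal.
apply/cvgrPdist_lt => e e0.
(* [al e] is the tolerance for the Lyapunov values: a state of norm at least [e] would keep them at
   or above [al e]. *)
have ale : 0 < al e by have [[_ + al0] _] := Kal; rewrite -{2}al0; apply.
have /cvgrPdist_lt : (\prod_(l < t) (lam (sigma l) * mu (sigma l) (sigma l.+1)))
    * V (sigma 0%N) x0 @[t --> \oo] --> 0.
  by rewrite -[X in _ --> X](mul0r (V (sigma 0%N) x0)); apply: cvgMl.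
move=> /(_ _ ale)[t0 _ ht]; exists t0 => // t t0t /=.
rewrite sub0r normrN ger0_norm ?enorm_ge0// ltNge; apply/negP => ex.
have : al e <= al (enorm (x t)).
  by move: ex; rewrite le_eqVlt => /predU1P[->//|?]; apply/ltW/al_incr => //; exact: ltW.
have /andP[+ _] := (hdec (sigma t) (x t) 0).1.
move=> h1 h2; have := le_trans (le_trans h2 h1) (bound t).
rewrite leNgt => /negP; apply; have := ht t t0t.
by rewrite /= sub0r normrN; apply: le_lt_trans; exact: ler_norm.
Qed.

End lyapunov_decay.

(** On the cycle [lam < 1], so [ln lam] is minus its absolute value and the one-period factor is the
    exponential of the cycle weight; a negative weight makes it a contraction. *)
Lemma cycle_GAS {R : realType} {N d m p : nat}
  (f : 'I_N -> 'cV[R]_d -> 'cV[R]_m -> 'cV[R]_d)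
  (h : 'I_N -> 'cV[R]_d -> 'cV[R]_p)
  (PS : {set 'I_N}) (E : {set 'I_N * 'I_N})
  (lam : 'I_N -> R) (mu : 'I_N -> 'I_N -> R) (A : 'I_N -> 'M[R]_d)
  (sigma : nat -> 'I_N) (c : seq 'I_N) :
  lyapunov_assumptions f h PS E lam mu ->
  (forall i xi eta, f i xi eta = A i *m xi) ->
  (forall i xi, h i xi = 0) ->
  uniq c -> (0 < size c)%N -> cycle (fun u w => w \in Nplus PS E u) c ->
  switching_construction 1 c sigma ->
  \sum_(v <- c) (ln (mu v (next c v)) - `|ln (lam v)|) < 0 ->
  GAS f sigma.
Proof.
move=> hlyap hlin hout uc c0 cyc hsigma neg.
have sigmaE := switching_construction_periodic c0 hsigma.
have sc t : sigma t \in c := periodic_mem c0 sigmaE t.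
have snext t : sigma t.+1 = next c (sigma t) := periodic_next c0 uc sigmaE t.
have cE v : v \in c -> (v \in PS) && ((v, next c v) \in E).
  (* Being an out-neighbour of its predecessor puts [v] in [PS]; the relation to its successor gives
     the edge. *)
  move=> vc; have := next_cycle cyc vc; have := prev_cycle cyc vc.
  by rewrite !inE => /andP[-> _] /andP[_ ->].
have tE t : (sigma t, sigma t.+1) \in E.
  by rewrite snext; have /andP[] := cE _ (sc t).
have lam01 v : v \in c -> 0 < lam v < 1.
  move=> /cE/andP[vPS _].
  by have [V [al [au [g1 [g2 [_ _ /(_ v)[/(_ vPS)]]]]]]] := hlyap.
have mu1 v : v \in c -> 1 <= mu v (next c v).
  move=> /cE/andP[_ vE].
  by have [V [al [au [g1 [g2 [_ _ _ _ /(_ _ _ vE)[]]]]]]] := hlyap.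
apply: (linear_GAS hlin); apply: (lyapunov_trajectory_cvg0 hlyap hout tE).
under eq_fun do under eq_bigr do rewrite snext.
apply: (@periodic_prod_cvg0 _ _ _ _ c0 sigmaE
  (fun v => lam v * mu v (next c v))) => [v vc|].
  have /andP[l0 _] := lam01 v vc.
  by rewrite mulr_gt0// (lt_le_trans ltr01)// mu1.
have -> : \prod_(v <- c) (lam v * mu v (next c v)) =
    expR (\sum_(v <- c) (ln (mu v (next c v)) - `|ln (lam v)|)).
  rewrite expR_sum big_seq [RHS]big_seq; apply: eq_bigr => v vc.
  have /andP[l0 l1] := lam01 v vc; have m1 := mu1 v vc.
  have m0 : 0 < mu v (next c v) by exact: lt_le_trans m1.
  rewrite ler0_norm ?opprK; last by apply: ln_le0; exact: ltW.
  by rewrite expRD !lnK ?posrE// mulrC.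
by rewrite expR_lt1.
Qed.

(** * The cycle detection algorithm *)

Section cycle_detection_run.
Context {R : realType} {N : nat} (PS : {set 'I_N}) (E : {set 'I_N * 'I_N}).

(** The probability is a product: a pick outside the unvisited out-neighbours contributes 0, and the
    final factor is 0 unless all out-neighbours of the last vertex have been visited. *)
Lemma walk_prob_neq0 (vis : seq 'I_N) v s : walk_prob R PS E vis v s != 0 ->
  [/\ path (fun u w => w \in Nplus PS E u) v s, uniq s,
      {in s, forall u, u \notin vis}
    & forall u, u \in Nplus PS E (last v s) -> (u \in vis) || (u \in s)].
Proof.
elim: s vis v => [|u s IH] vis v /=.
  case: (_ =P finset.set0) => [C0 _|_] /=; last by rewrite eqxx.
  split=> // u uN; rewrite orbF; apply/negPn/negP => uvis.
  by have := finset.in_set0 u; rewrite -C0 inE uN uvis.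
case: ifP => [|_]; last by rewrite eqxx.
rewrite inE => /andP[uN uvis]; rewrite mulf_eq0 negb_or => /andP[_ /IH].
move=> [ps us hs hl]; split.
- by rewrite uN.
- by rewrite us andbT; apply/negP => /hs; rewrite mem_head.
- move=> x; rewrite inE => /predU1P[->//|/hs].
  by rewrite inE negb_or => /andP[].
- by move=> x /hl; rewrite !inE => /orP[/orP[->|->]|->]; rewrite ?orbT.
Qed.

(** All out-neighbours in [PS] of the last vertex [l] are on the walk. Closing at the first of them
    keeps them all on the cycle, together with [l], whence the length bound. *)
Lemma cycle_of_run_cycle s : (forall i j, (i, j) \in E -> i != j) ->
  (forall v, (0 < #|Nplus PS E v|)%N) -> run_prob R PS E s != 0 ->
  let c := cycle_of_run PS E s in
  [/\ uniq c, cycle (fun u w => w \in Nplus PS E u) c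
    & exists v, (#|Nplus PS E v| < size c)%N].
Proof.
move=> hE hN; case: s => [|v s] /=; first by rewrite eqxx.
case: ifP => [vPS|_]; last by rewrite eqxx.
rewrite mulf_eq0 negb_or => /andP[_ /walk_prob_neq0[ps us hs hl]].
set l := last v s in hl *; set a := fun u => _.
have uvs : uniq (v :: s).
  by rewrite /= us andbT; apply/negP => /hs; rewrite mem_head.
have hl' u : u \in Nplus PS E l -> u \in v :: s.
  by move=> /hl; rewrite !inE.
set t := v :: s in uvs hl' *.
have hasa : has a t.
  have /card_gt0P[u uN] := hN l.
  by apply/hasP; exists u => //; exact: hl'.
have ft : (find a t < size t)%N by rewrite -has_find.
set c := drop _ _.
have lc : l = last v c.
  rewrite /l -(last_cons v v s) -/t -[in LHS](cat_take_drop (find a t) t) last_cat -/c.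
  have : c != [::] by rewrite -size_eq0 size_drop subn_eq0 -ltnNge.
  by case: (c).
have sub : {subset l :: enum (Nplus PS E l) <= c}.
  move=> u; rewrite inE mem_enum => /predU1P[->|uN].
    rewrite lc.
    have : c != [::] by rewrite -size_eq0 size_drop subn_eq0 -ltnNge.
    by case: (c) => //= x r _; exact: mem_last.
  (* The part cut off precedes the first vertex satisfying [a], so it contains no out-neighbour of
     [l]. *)
  have := hl' u uN; rewrite -[t](cat_take_drop (find a t)) mem_cat => /orP[|//].
  move=> /(nthP v)[i]; rewrite size_takel ?(ltnW ft)// => ift; rewrite nth_take//.
  by move=> iu; have := before_find v ift; rewrite iu /a uN.
split.
- exact: drop_uniq.
- have : path (fun u w => w \in Nplus PS E u) v s by [].
  have : c = nth v t (find a t) :: drop (find a t).+1 t by rewrite -drop_nth.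
  have := nth_find v hasa; rewrite {1}/a => aN cE ps'.
  rewrite cE /= rcons_path.
  have -> : last (nth v t (find a t)) (drop (find a t).+1 t) = l.
    by rewrite lc cE.
  rewrite aN andbT.
  have : sorted (fun u w => w \in Nplus PS E u) c by apply: drop_sorted.
  by rewrite cE.
(* The inequality is strict because [l] is counted too: without loops it is not its own
   out-neighbour. *)
- exists l; rewrite cardE; apply: (uniq_leq_size _ sub).
  rewrite /= enum_uniq andbT mem_enum inE.
  by apply/negP => /andP[_ /hE]; rewrite eqxx.
Qed.

End cycle_detection_run.

(** * Concentration of the cycle weight *)

Section bounded_measurable.
Context {R : realType} {disp : measure_display} {T : measurableType disp}.
Variable P : probability T R.
Implicit Types X Y H : T -> R.

Lemma Rintegral_cst_probability (r : R) : \int[P]_w r = r.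
Proof.
rewrite Rintegral_cst//.
have -> : fine (P [set: T]) = 1 by rewrite probability_setT.
by rewrite mulr1.
Qed.

(** The bound holds everywhere, not just almost surely, so sums and products stay in the class
    without handling null sets. *)
Definition bounded_mfun X :=
  measurable_fun setT X /\ exists K, forall w, `|X w| <= K.

Lemma bounded_mfun_cst r : bounded_mfun (fun=> r).
Proof. by split; [exact: measurable_cst|exists `|r|]. Qed.

Lemma bounded_mfunD X Y :
  bounded_mfun X -> bounded_mfun Y -> bounded_mfun (fun w => X w + Y w).
Proof.
move=> [mX [K hK]] [mY [L hL]]; split; first exact: measurable_funD.
by exists (K + L) => w; apply: le_trans (ler_normD _ _) _; apply: lerD.
Qed.

Lemma bounded_mfunM X Y :
  bounded_mfun X -> bounded_mfun Y -> bounded_mfun (fun w => X w * Y w).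
Proof.
move=> [mX [K hK]] [mY [L hL]]; split; first exact: measurable_funM.
by exists (K * L) => w; rewrite normrM ler_pM.
Qed.

Lemma bounded_mfunN X : bounded_mfun X -> bounded_mfun (fun w => - X w).
Proof.
move=> [mX [K hK]]; split; first exact: measurableT_comp.
by exists K => w; rewrite normrN.
Qed.

Lemma bounded_mfun_indic (B : set T) : measurable B -> bounded_mfun (\1_B).
Proof.
move=> mB; split; first exact: measurable_indic.
by exists 1 => w; rewrite indicE; case: (_ \in _); rewrite ?normr1 ?normr0.
Qed.

Lemma bounded_mfun_sum (I : eqType) (s : seq I) (F : I -> T -> R) :
  (forall i, i \in s -> bounded_mfun (F i)) ->
  bounded_mfun (fun w => \sum_(i <- s) F i w).
Proof.
elim: s => [|i s IH] hF.
  by under eq_fun do rewrite big_nil; exact: bounded_mfun_cst.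
under eq_fun do rewrite big_cons.
apply: bounded_mfunD; first by apply: hF; rewrite mem_head.
by apply: IH => j js; apply: hF; rewrite inE js orbT.
Qed.

Lemma bounded_mfun_prod (I : eqType) (s : seq I) (F : I -> T -> R) :
  (forall i, i \in s -> bounded_mfun (F i)) ->
  bounded_mfun (fun w => \prod_(i <- s) F i w).
Proof.
elim: s => [|i s IH] hF.
  by under eq_fun do rewrite big_nil; exact: bounded_mfun_cst.
under eq_fun do rewrite big_cons.
apply: bounded_mfunM; first by apply: hF; rewrite mem_head.
by apply: IH => j js; apply: hF; rewrite inE js orbT.
Qed.

Lemma bounded_mfun_integrable X (D : set T) :
  measurable D -> bounded_mfun X ->
  P.-integrable D (EFin \o X).
Proof.
move=> mD [mX [K hK]]; apply: measurable_bounded_integrable => //.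
- by apply: le_lt_trans (probability_le1 P mD) _; rewrite ltry.
- exact: measurable_funTS.
- exists K; split; first exact: num_real.
  by move=> x Kx w _ /=; apply: le_trans (hK w) (ltW Kx).
Qed.

Lemma Rintegral_mulr_indic X (B : set T) : measurable B ->
  \int[P]_w (X w * \1_B w) = \int[P]_(w in B) X w.
Proof.
move=> mB; rewrite [RHS]Rintegral_mkcond; apply: eq_Rintegral => w _.
by rewrite patchE indicE; case: (_ \in _); rewrite ?mulr1 ?mulr0.
Qed.

(** The sum counts the integers from 1 to [m] that are at most [y], so it is the integer part of
    [y]. *)
Lemma dist_sum_indic_le1 (y : R) (m : nat) : 0 <= y <= m%:R ->
  `|y - \sum_(k < m) (k.+1%:R <= y)%R%:R| <= 1.
Proof.
elim: m => [|m IH] /andP[y0 ym].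
  have -> : y = 0 by apply/le_anti; rewrite y0 ym.
  by rewrite big_ord0 subr0 normr0.
rewrite big_ord_recr /=; have [ym'|my] := leP y m%:R.
  have -> : (m.+1%:R <= y) = false.
    by apply/negbTE; rewrite -ltNge (le_lt_trans ym')// ltr_nat.
  by rewrite addr0; apply: IH; rewrite y0.
rewrite (eq_bigr (fun=> 1)) => [|k _]; last first.
  suff -> : k.+1%:R <= y by [].
  by apply: le_trans (ltW my); rewrite ler_nat.
rewrite sumr_const card_ord ler_distl.
move: ym; rewrite -natr1 => ym; case: (leP (m%:R + 1) y) => h /=; lra.
Qed.

(* H is approximated, up to 1 / n, by nonnegative combinations of indicators
   of its superlevel sets. *)
Lemma Rintegral_mul_ge0 (G : set (set T)) X H (L : R) :
  G `<=` measurable -> bounded_mfun X ->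
  (forall B, G B -> 0 <= \int[P]_(w in B) X w) ->
  (forall r, G [set w | r <= H w]) -> (forall w, 0 <= H w <= L) ->
  measurable_fun setT H ->
  0 <= \int[P]_w (X w * H w).
Proof.
move=> Gm bX GX GH hHL mH.
have bH : bounded_mfun H.
  by split=> //; exists L => w; have /andP[h0 hL] := hHL w; rewrite ger0_norm.
have [K hK] : exists K : R, forall w, `|X w| <= K := bX.2.
(* The error after scaling by [n] is at most [K] whatever [n] is, which for large [n] rules out a
   negative integral. *)
have key n : - K <= n%:R * \int[P]_w (X w * H w).
  have [n0|n0] := posnP n.
    have [w] : exists w : T, True by exists point.
    by rewrite n0 mul0r oppr_le0 => _; apply: le_trans (hK w).
  have [m nLm] : exists m : nat, n%:R * L <= m%:R.
    by exists (Num.bound (n%:R * L)); exact/ltW/ltr_bound.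
  pose B k := [set w | (k.+1)%:R / n%:R <= H w].
  have mB k : measurable (B k) by apply: Gm; exact: GH.
  pose S := fun w => \sum_(k < m) \1_(B k) w : R.
  have bS : bounded_mfun S.
    by apply: bounded_mfun_sum => k _; exact: bounded_mfun_indic.
  have dS w : `|n%:R * H w - S w| <= 1.
    have /andP[h0 hL] := hHL w.
    have -> : S w = \sum_(k < m) ((k.+1)%:R <= n%:R * H w)%R%:R.
      apply: eq_bigr => k _; rewrite indicE; congr ((nat_of_bool _)%:R).
      by apply/idP/idP; rewrite inE /B /= ler_pdivrMr ?ltr0n// [H w * _]mulrC.
    apply: dist_sum_indic_le1; rewrite mulr_ge0//=.
    by apply: le_trans nLm; rewrite ler_wpM2l.
  have iT := bounded_mfun_integrable measurableT.
  have S0 : 0 <= \int[P]_w (X w * S w).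
    rewrite /S; elim: (m) => [|j IH].
      under eq_Rintegral do rewrite big_ord0 mulr0.
      by rewrite Rintegral_cst// mul0r.
    under eq_Rintegral do rewrite big_ord_recr mulrDr /=.
    have bI k : bounded_mfun (\1_(B k)) by exact: bounded_mfun_indic.
    rewrite RintegralD//.
    - rewrite addr_ge0// Rintegral_mulr_indic//.
      by apply: GX; exact: GH.
    - by apply/iT/bounded_mfunM => //; apply: bounded_mfun_sum.
    - by apply/iT/bounded_mfunM.
  rewrite -RintegralZl//; last by apply/iT/bounded_mfunM.
  have -> : \int[P]_w (n%:R * (X w * H w)) =
      \int[P]_w (X w * S w + X w * (n%:R * H w - S w)).
    by apply: eq_Rintegral => w _; ring.
  have bE : bounded_mfun (fun w => X w * (n%:R * H w - S w)).
    apply: bounded_mfunM => //; apply: bounded_mfunD; last exact: bounded_mfunN.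
    by apply: bounded_mfunM => //; exact: bounded_mfun_cst.
  rewrite RintegralD//; [|by apply/iT/bounded_mfunM|exact: iT].
  rewrite ler_wpDl//.
  have -> : - K = \int[P]_w (- K).
    by rewrite Rintegral_cst_probability.
  apply: le_Rintegral => //; [apply/iT/bounded_mfun_cst|exact: iT|].
  move=> w _; rewrite lerNl; apply: le_trans (ler_norm _) _.
  by rewrite normrN normrM -[K]mulr1 ler_pM.
rewrite leNgt; apply/negP => I0.
have := ltr_bound (K / - \int[P]_w (X w * H w)).
set n := Num.bound _; rewrite ltr_pdivrMr ?oppr_gt0// mulrN => h.
by have := key n; rewrite lerNl leNgt h.
Qed.

End bounded_measurable.

(* Weighted AM-GM: (1 + e)^((1 + x) / 2) * (1 - e)^((1 - x) / 2) <= 1 + e x. *)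
Lemma expR_affine_le {R : realType} (e x : R) : 0 <= e < 1 -> -1 <= x <= 1 ->
  expR (2^-1 * (ln (1 + e) + ln (1 - e)) + 2^-1 * (ln (1 + e) - ln (1 - e)) * x)
  <= 1 + e * x.
Proof.
move=> /andP[e0 e1] /andP[x0 x1].
have p01 : 0 <= (1 + x) / 2 <= 1 by apply/andP; split; lra.
have := convex_expR (Itv01 (andP p01).1 (andP p01).2) (ln (1 + e)) (ln (1 - e)).
rewrite !convRE /= !lnK ?posrE; [|lra|lra].
set u := ln _; set v := ln _; rewrite /onem => h.
have -> : 2^-1 * (u + v) + 2^-1 * (u - v) * x
  = (1 + x) / 2 * u + (1 - (1 + x) / 2) * v by field.
by apply: le_trans h _; rewrite le_eqVlt; apply/orP; left; apply/eqP; field.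
Qed.

(** * Generated sigma-algebras and the Chernoff bound *)

Section concentration.
Context {R : realType} {disp : measure_display} {T : measurableType disp}.
Variable P : probability T R.

Lemma sub_sigma_of_measurable (F : set (T -> R)) :
  (forall X, F X -> measurable_fun setT X) -> sigma_of F `<=` measurable.
Proof.
move=> mF; apply: smallest_sub; first exact: sigma_algebra_measurable.
by move=> _ [X FX [B mB <-]]; rewrite -[_ @^-1` _]setTI; exact: mF.
Qed.

Lemma sigma_of_preimage (F : set (T -> R)) X (B : set R) :
  F X -> measurable B -> sigma_of F (X @^-1` B).
Proof. by move=> FX mB; apply: sub_sigma_algebra; exists X => //; exists B. Qed.

(** Retyping the domain turns membership of preimages in [sigma_of F] into ordinary measurability,
    so the closure properties of measurable functions apply to the sub-sigma-algebra. *)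
Lemma measurable_fun_sigma_of (F : set (T -> R)) X : F X ->
  measurable_fun setT
    (X : g_sigma_algebraType [set X @^-1` B | X in F & B in measurable] -> R).
Proof.
by move=> FX _ B mB; rewrite setTI; exact: sigma_of_preimage.
Qed.

Lemma sigma_of_comp (F G : set (T -> R)) :
  (forall X, F X -> measurable_fun setT
    (X : g_sigma_algebraType [set X @^-1` B | X in G & B in measurable] -> R)) ->
  sigma_of F `<=` sigma_of G.
Proof.
move=> mF; apply: smallest_sub; first exact: smallest_sigma_algebra.
move=> _ [X FX [B mB <-]].
by have := mF X FX measurableT B mB; rewrite setTI.
Qed.

Variables (I : eqType) (D : I -> T -> R) (C delta : R).
Hypothesis (C0 : 0 < C) (delta0 : 0 <= delta) (deltaC : delta < C).

(** One factor is removed at a time. The product [H] of the others is nonnegative and measurable for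
    the other terms, so the integral of [D i * H] is at most [- delta] times that of [H]; removing
    the factor then costs [1 - (delta / C) ^+ 2]. *)
Lemma expectation_prod_le (s : seq I) : uniq s ->
  (forall i, i \in s -> measurable_fun setT (D i)) ->
  (forall i, i \in s -> forall w, `|D i w| <= C) ->
  (forall i, i \in s -> forall B : set T,
    sigma_of [set D j | j in [set j | j \in s /\ j != i]] B ->
    \int[P]_(w in B) D i w <= - delta * fine (P B)) ->
  \int[P]_w (\prod_(i <- s) (1 + delta / C * (D i w / C)))
  <= (1 - (delta / C) ^+ 2) ^+ size s.
Proof.
move=> us mD hD hG.
have e0 : 0 <= delta / C by rewrite divr_ge0// ltW.
have e1 : delta / C < 1 by rewrite ltr_pdivrMr// mul1r.
have D1 i w : i \in s -> -1 <= D i w / C <= 1.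
  move=> si; rewrite ler_pdivlMr// ler_pdivrMr// mulN1r mul1r -ler_norml.
  exact: hD.
have fac i w : i \in s -> 0 <= 1 + delta / C * (D i w / C) <= 2.
  by move=> /(D1 i w) /andP[h1 h2]; apply/andP; split; nra.
have bD i : i \in s -> bounded_mfun (D i).
  by move=> si; split; [exact: mD|exists C => w; exact: hD].
have bfac i : i \in s -> bounded_mfun (fun w => 1 + delta / C * (D i w / C)).
  move=> si; apply: bounded_mfunD; first exact: bounded_mfun_cst.
  apply: bounded_mfunM; first exact: bounded_mfun_cst.
  by apply: bounded_mfunM; [exact: bD|exact: bounded_mfun_cst].
have iT := bounded_mfun_integrable P measurableT.
(* Only the list multiplied over shrinks in the induction; the hypotheses keep conditioning on all
   other members of [s]. *)
have : {subset s <= s} by [].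
move: {1 2 4 5}s us; elim=> [_ _|i t IH /= /andP[it ut] ts].
  under eq_Rintegral do rewrite big_nil.
  by rewrite Rintegral_cst_probability /= expr0.
have si : i \in s by apply: ts; rewrite mem_head.
have ts' : {subset t <= s} by move=> j jt; apply: ts; rewrite inE jt orbT.
have {}IH := IH ut ts'.
set H := fun w => \prod_(j <- t) (1 + delta / C * (D j w / C)) in IH *.
have bH : bounded_mfun H by apply: bounded_mfun_prod => j /ts'; exact: bfac.
have hH w : 0 <= H w <= 2 ^+ size t.
  rewrite /H; elim: (t) ts' => [|j r IHr] rs; first by rewrite big_nil lexx ler01.
  rewrite big_cons exprS.
  have /andP[h0 h2] := fac j w (rs _ (mem_head _ _)).
  have /andP[g0 g2] := IHr (fun k kr => rs _ (@mem_behead _ (j :: r) _ kr)).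
  by rewrite mulr_ge0//= ler_pM.
have {}hG := hG i si.
set G := sigma_of [set D j | j in [set j | j \in s /\ j != i]] in hG *.
have Gm : G `<=` measurable.
  by apply: sub_sigma_of_measurable => _ [j [js _] <-]; exact: mD.
(* [H] involves only terms [D j] with [j] in [t], hence [j != i]. *)
have GH r : G [set w | r <= H w].
  suff mH : measurable_fun setT (H : g_sigma_algebraType
      [set X @^-1` B | X in [set D j | j in [set j | j \in s /\ j != i]]
                     & B in measurable] -> R).
    have := mH measurableT [set` `[r, +oo[] (measurable_itv _).
    rewrite setTI; congr (G _); apply/seteqP; split=> w /=;
      by rewrite in_itv /= andbT.
  apply: measurable_prod => j jt; apply: measurable_funD => //.
  apply: measurable_funM => //; apply: measurable_funM => //.
  apply: measurable_fun_sigma_of; exists j => //; split; first exact: ts'.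
  by apply: contraNneq it => <-.
have bX : bounded_mfun (fun w => - delta - D i w).
  apply: bounded_mfunD; first exact: bounded_mfun_cst.
  by apply: bounded_mfunN; exact: bD.
have /= := @Rintegral_mul_ge0 _ _ _ P _ _ _ _ Gm bX _ GH hH bH.1.
have -> : \int[P]_w ((- delta - D i w) * H w)
    = - delta * \int[P]_w H w - \int[P]_w (D i w * H w).
  rewrite -RintegralZl//; last exact: iT.
  rewrite -RintegralB//; last 2 first.
  - by apply/iT/bounded_mfunM => //; exact: bounded_mfun_cst.
  - by apply/iT/bounded_mfunM => //; exact: bD.
  by apply: eq_Rintegral => w _; rewrite mulrBl.
rewrite subr_ge0 => main.
have {}main : \int[P]_w (D i w * H w) <= - delta * \int[P]_w H w.
  apply: main => B GB; have mB := Gm _ GB.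
  rewrite RintegralB//; last 2 first.
  - exact/bounded_mfun_integrable/bounded_mfun_cst.
  - by apply: bounded_mfun_integrable => //; exact: bD.
  by rewrite Rintegral_cst// subr_ge0; exact: hG.
have -> : \int[P]_w (\prod_(j <- i :: t) (1 + delta / C * (D j w / C)))
    = \int[P]_w H w + delta / C / C * \int[P]_w (D i w * H w).
  rewrite -RintegralZl//; last by apply/iT/bounded_mfunM => //; exact: bD.
  rewrite -RintegralD//; [|exact: iT|]; last first.
    apply/iT/bounded_mfunM; first exact: bounded_mfun_cst.
    by apply: bounded_mfunM => //; exact: bD.
  by apply: eq_Rintegral => w _; rewrite big_cons -/(H w); ring.
rewrite exprS.
have : delta / C / C * \int[P]_w (D i w * H w)
    <= delta / C / C * (- delta * \int[P]_w H w).
  by rewrite ler_wpM2l// divr_ge0// ltW.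
have -> : delta / C / C * (- delta * \int[P]_w H w)
  = - (delta / C) ^+ 2 * \int[P]_w H w by field; rewrite gt_eqF.
have : (1 - (delta / C) ^+ 2) * \int[P]_w H w <=
       (1 - (delta / C) ^+ 2) * (1 - (delta / C) ^+ 2) ^+ size t.
  by rewrite ler_wpM2l// subr_ge0 expr_le1// ltW.
rewrite mulrBl mul1r.
by move=> h1 h2; apply: le_trans h1; rewrite -lerBrDl mulNr in h2 *; lra.
Qed.

Lemma concentration (s : seq I) : uniq s ->
  (forall i, i \in s -> measurable_fun setT (D i)) ->
  (forall i, i \in s -> forall w, `|D i w| <= C) ->
  (forall i, i \in s -> forall B : set T,
    sigma_of [set D j | j in [set j | j \in s /\ j != i]] B ->
    \int[P]_(w in B) D i w <= - delta * fine (P B)) ->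
  (P [set w | (0 <= \sum_(i <- s) D i w)%R] <=
   (expR (- (2^-1 * (delta / C) ^+ 2 * (size s)%:R)))%:E)%E.
Proof.
move=> us mD hD hG.
have e0 : 0 <= delta / C by rewrite divr_ge0// ltW.
have e1 : delta / C < 1 by rewrite ltr_pdivrMr// mul1r.
have Eprod := expectation_prod_le us mD hD hG.
set e := delta / C in e0 e1 Eprod *.
(* [c] is half the logarithm of [1 - e ^+ 2], the constant part of each exponent in
   [expR_affine_le]. *)
set c := 2^-1 * (ln (1 + e) + ln (1 - e)).
have cE : 1 - e ^+ 2 = expR (2 * c).
  have -> : 2 * c = ln (1 + e) + ln (1 - e) by rewrite /c; field.
  by rewrite expRD !lnK ?posrE; [ring|lra|lra].
have c_le : c <= - (2^-1 * e ^+ 2).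
  have := expR_ge1Dx (2 * c); rewrite -cE => h; lra.
have bD i : i \in s -> bounded_mfun (D i).
  by move=> si; split; [exact: mD|exists C => w; exact: hD].
have mS : measurable [set w | 0 <= \sum_(i <- s) D i w].
  have [mSum _] := bounded_mfun_sum bD.
  have := mSum measurableT [set` `[0, +oo[] (measurable_itv _).
  rewrite setTI; congr (measurable _); apply/seteqP; split=> w /=;
    by rewrite in_itv /= andbT.
set S := [set w | _] in mS *.
have PS : fine (P S) = \int[P]_w \1_S w.
  under eq_Rintegral do rewrite -[\1_S _]mul1r.
  rewrite Rintegral_mulr_indic// Rintegral_cst//.
  by rewrite mul1r.
have finP : P S \is a fin_num by exact: fin_num_measure.
rewrite -(fineK finP) lee_fin PS.
have prodE w : \prod_(i <- s) expR (c + 2^-1 * (ln (1 + e) - ln (1 - e)) * (D i w / C))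
  = expR (c * (size s)%:R + 2^-1 * (ln (1 + e) - ln (1 - e)) / C * \sum_(i <- s) D i w).
  elim: (s) => [|i t IH]; first by rewrite !big_nil !mulr0 addr0 expR0.
  by rewrite !big_cons IH -expRD /= -natr1; congr expR; ring.
have lnee : 0 <= ln (1 + e) - ln (1 - e).
  by rewrite subr_ge0 ler_ln ?posrE; lra.
(* On [S] the sum and its coefficient are nonnegative, so the tilted exponential is at least
   [expR (c * size s)]; its factors are then bounded by affine ones. *)
have pt w : expR (c * (size s)%:R) * \1_S w
    <= \prod_(i <- s) (1 + e * (D i w / C)).
  apply: (@le_trans _ _ (\prod_(i <- s)
    expR (c + 2^-1 * (ln (1 + e) - ln (1 - e)) * (D i w / C)))).
    rewrite prodE indicE; have [|_] := boolP (w \in S); last first.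
      by rewrite mulr0 expR_ge0.
    rewrite inE /S /= => S0.
    rewrite mulr1 ler_expR lerDl mulr_ge0// divr_ge0//; last exact: ltW.
    by rewrite mulr_ge0// invr_ge0.
  rewrite big_seq [leRHS]big_seq; apply: ler_prod => i si.
  rewrite expR_ge0 /=; apply: expR_affine_le; first by rewrite e0.
  rewrite ler_pdivlMr// ler_pdivrMr// mulN1r mul1r -ler_norml.
  exact: hD.
(* The bound on the product is the square of the prefactor; cancelling one copy leaves the power
   [size s / 2] of [1 - e ^+ 2]. *)
have : expR (c * (size s)%:R) * \int[P]_w \1_S w <= expR (c * (size s)%:R) ^+ 2.
  rewrite -RintegralZl//; last first.
    by apply: bounded_mfun_integrable => //; exact: bounded_mfun_indic.
  apply: le_trans (le_Rintegral _ _ _ (fun w _ => pt w)) _ => //.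
  - apply: bounded_mfun_integrable => //; apply: bounded_mfunM.
      exact: bounded_mfun_cst.
    exact: bounded_mfun_indic.
  - apply: bounded_mfun_integrable => //; apply: bounded_mfun_prod => i si.
    apply: bounded_mfunD; first exact: bounded_mfun_cst.
    apply: bounded_mfunM; first exact: bounded_mfun_cst.
    by apply: bounded_mfunM; [exact: bD|exact: bounded_mfun_cst].
  apply: le_trans Eprod _; rewrite cE -!expRM_natr.
  by rewrite le_eqVlt; apply/orP; left; apply/eqP; congr expR; ring.
rewrite expr2 ler_pM2l ?expR_gt0// => h; apply: le_trans h _.
by rewrite ler_expR -mulNr ler_wpM2r.
Qed.

End concentration.

(** * Almost sure bounds and conditional expectations *)

Section almost_everywhere.
Context {R : realType} {disp : measure_display} {T : measurableType disp}.
Variable P : probability T R.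

Lemma le_probability_ae (A B : set T) : measurable A -> measurable B ->
  {ae P, forall w, A w -> B w} -> (P A <= P B)%E.
Proof.
move=> mA mB [N [mN N0 subN]].
have -> : P B = P (B `|` N) by rewrite measureU0.
apply: le_measure; rewrite ?inE//; first exact: measurableU.
move=> w Aw; have [Bw|nBw] := pselect (B w); [by left|right].
by apply: subN => /= AB; exact: nBw (AB Aw).
Qed.

Lemma Rintegral_ge0_ae (B : set T) (Z : T -> R) : measurable B ->
  measurable_fun setT Z -> {ae P, forall w, 0 <= Z w} ->
  0 <= \int[P]_(w in B) Z w.
Proof.
move=> mB mZ Z0; rewrite /Rintegral.
rewrite (ae_eq_integral (fun w => (Num.max 0 (Z w))%:E))//.
- by apply: fine_ge0; apply: integral_ge0 => w _; rewrite lee_fin le_max lexx.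
- by apply/measurable_EFinP; exact: measurable_funTS.
- apply/measurable_EFinP; apply: measurable_funTS.
  by apply: measurable_maxr => //; exact: measurable_cst.
- by move: Z0; apply: filterS => w Z0 _; rewrite max_r.
Qed.

Variables (G : set (set T)) (X Y X' : T -> R).
Hypothesis condY : is_cond_exp P G X Y.
Hypothesis mX : measurable_fun setT X.
Hypothesis bX' : bounded_mfun X'.
Hypothesis XX' : {ae P, forall w, X' w = X w}.

(** [X'] stands for an everywhere bounded modification of [X]; integrals over events do not see the
    difference. *)
Lemma cond_exp_Rintegral B : measurable B -> G B ->
  \int[P]_(w in B) X' w = \int[P]_(w in B) Y w.
Proof.
move=> mB GB; have [_ _ YX] := condY.
rewrite /Rintegral YX//; congr fine; apply: ae_eq_integral => //.
- by apply/measurable_EFinP; apply: measurable_funTS; exact: bX'.1.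
- by apply/measurable_EFinP; exact: measurable_funTS.
- by move: XX'; apply: filterS => w -> _.
Qed.

Lemma cond_exp_integrable B : measurable B -> P.-integrable B (EFin \o Y).
Proof. by move=> mB; have [iY _ _] := condY; apply: integrableS iY. Qed.

Lemma cond_exp_measurable : measurable_fun setT Y.
Proof.
have [iY _ _] := condY; apply/measurable_EFinP; exact: measurable_int iY.
Qed.

Lemma cond_exp_le a B : {ae P, forall w, Y w <= a} -> measurable B -> G B ->
  \int[P]_(w in B) X' w <= a * fine (P B).
Proof.
move=> Ya mB GB; rewrite cond_exp_Rintegral// -subr_ge0 -Rintegral_cst//.
rewrite -RintegralB//; last 2 first.
- exact/bounded_mfun_integrable/bounded_mfun_cst.
- exact: cond_exp_integrable.
apply: Rintegral_ge0_ae => //.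
- by apply: measurable_funB; [exact: measurable_cst|exact: cond_exp_measurable].
- by move: Ya; apply: filterS => w; rewrite subr_ge0.
Qed.

Lemma cond_exp_ge a B : {ae P, forall w, a <= Y w} -> measurable B -> G B ->
  a * fine (P B) <= \int[P]_(w in B) X' w.
Proof.
move=> Ya mB GB; rewrite cond_exp_Rintegral// -subr_ge0 -Rintegral_cst//.
rewrite -RintegralB//; last 2 first.
- exact: cond_exp_integrable.
- exact/bounded_mfun_integrable/bounded_mfun_cst.
apply: Rintegral_ge0_ae => //.
- by apply: measurable_funB; [exact: cond_exp_measurable|exact: measurable_cst].
- by move: Ya; apply: filterS => w; rewrite subr_ge0.
Qed.

End almost_everywhere.

Section clamp.
Context {R : realType}.

(** Truncation makes an almost sure bound hold everywhere, changes the variable only on a null set,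
    and preserves measurability for any sigma-algebra. *)
Definition clamp (a b x : R) := Num.max a (Num.min b x).

Lemma clamp_itv a b x : a <= b -> a <= clamp a b x <= b.
Proof. by move=> ab; rewrite /clamp le_max lexx ge_max ab ge_min lexx. Qed.

Lemma clamp_id a b x : a <= x <= b -> clamp a b x = x.
Proof. by move=> /andP[ax xb]; rewrite /clamp min_r// max_r. Qed.

Lemma measurable_clamp {disp : measure_display} {T : measurableType disp}
  a b (X : T -> R) :
  measurable_fun setT X -> measurable_fun setT (fun w => clamp a b (X w)).
Proof.
move=> mX; apply: measurable_maxr; first exact: measurable_cst.
by apply: measurable_minr => //; exact: measurable_cst.
Qed.

End clamp.

(** * Tail of the weight of a fixed cycle *)

Section cycle_weight.
Context {R : realType} {disp : measure_display} {T : measurableType disp}.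
Variable P : probability T R.
Context {N : nat} (E : {set 'I_N * 'I_N}).
Variables (wv : 'I_N -> T -> R) (we : 'I_N * 'I_N -> T -> R).
Hypothesis mwv : forall v, measurable_fun setT (wv v).
Hypothesis mwe : forall e, measurable_fun setT (we e).

(** For a cycle inside [PS], where vertex weights are nonpositive, this is the total weight of
    vertices and edges; [next] includes the closing edge. *)
Definition cycle_weight (c : seq 'I_N) (w : T) : R :=
  \sum_(v <- c) (we (v, next c v) w - `|wv v w|).

(** Independence of the walk is granted for events of [sigma_weights]; this places the events about
    the cycle weight there. *)
Lemma sigma_weights_cycle_weight (c : seq 'I_N) (B : set R) :
  (forall v, v \in c -> (v, next c v) \in E) -> measurable B ->
  sigma_weights E wv we (cycle_weight c @^-1` B).
Proof.
move=> cE mB; rewrite /sigma_weights /sigma_of.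
set G := [set X @^-1` B0 | X in _ & B0 in _].
suff m : measurable_fun setT (cycle_weight c : g_sigma_algebraType G -> R).
  by have := m measurableT B mB; rewrite setTI.
have cs : {subset c <= c} by [].
rewrite /cycle_weight; move: {1 3}c cs; elim=> [_|v s IH vs].
  by under eq_fun do rewrite big_nil; exact: measurable_cst.
under eq_fun do rewrite big_cons.
apply: measurable_funD; last by apply: IH => u us; apply: vs; rewrite inE us orbT.
apply: measurable_funB.
  apply: measurable_fun_sigma_of; right; exists (v, next c v) => //.
  by apply/cE/vs; rewrite mem_head.
apply: measurableT_comp => //.
by apply: measurable_fun_sigma_of; left; exists v.
Qed.

(** [concentration] is applied to the clamped differences [D] with [C = A + B] and
    [delta = beta - alpha]. The other terms generate a sigma-algebra inside both [GX v] and [GY v],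
    so the two conditional mean bounds can be subtracted. *)
Lemma cycle_weight_tail Dm DM (beta B A alpha : R) (c : seq 'I_N) :
  nicely_weighted_with P E wv we Dm DM 1 beta B A alpha ->
  uniq c -> (0 < size c)%N -> (forall v, v \in c -> (v, next c v) \in E) ->
  (P [set w | (0 <= cycle_weight c w)%R] <=
   (expR (- (2^-1 * ((alpha - beta) / (A + B)) ^+ 2 * (size c)%:R)))%:E)%E.
Proof.
move=> [_ [/andP[beta0 betaB] hv] [A0 ab] he] uc c0 cE.
pose Y := abs_scaled wv 1.
pose X v := we (v, next c v).
pose X' v w := clamp (- A) A (X v w); pose Y' v w := clamp 0 B (Y v w).
pose D v w := X' v w - Y' v w.
have B0 : 0 < B by exact: lt_trans betaB.
have AA : - A <= A by rewrite ge0_cp// ltW.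
have mY v : measurable_fun setT (Y v).
  by apply: measurable_funM => //; exact: measurableT_comp.
have bX' v : bounded_mfun (X' v).
  split; first exact: (measurable_clamp _ _ (mwe (v, next c v))).
  by exists A => w; rewrite ler_norml; exact: clamp_itv.
have bY' v : bounded_mfun (Y' v).
  split; first exact: (measurable_clamp _ _ (mY v)).
  exists B => w; have /andP[y0 yB] := clamp_itv (Y v w) (ltW B0).
  by rewrite ger0_norm.
have XX' v : v \in c -> {ae P, forall w, X' v w = X v w}.
  move=> /cE/he[hX _]; move: hX; apply: filterS => w; exact: clamp_id.
have YY' v : {ae P, forall w, Y' v w = Y v w}.
  have [hY _] := hv v; move: hY; apply: filterS => w /andP[y0 yB].
  by apply: clamp_id; rewrite (ltW y0).
have mD v : measurable_fun setT (D v).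
  by apply: measurable_funB; [exact: (bX' v).1|exact: (bY' v).1].
have hD v w : `|D v w| <= A + B.
  have /andP[x0 x1] := clamp_itv (X v w) AA.
  have /andP[y0 y1] := clamp_itv (Y v w) (ltW B0).
  by rewrite ler_norml /D /X' /Y'; apply/andP; split; lra.
pose GX v := sigma_of (range Y `|`
  [set we e' | e' in [set e' | e' \in E /\ e' != (v, next c v)]]).
pose GY v := sigma_of ([set Y l | l in [set l | l != v]] `|`
  [set we e | e in [set e | e \in E]]).
have GXX v S : v \in c -> measurable S -> GX v S ->
    \int[P]_(w in S) X' v w <= alpha * fine (P S).
  move=> vc mS GS; have [_ [Z [cZ Zalpha]]] := he _ (cE _ vc).
  exact: (cond_exp_le cZ (mwe _) (bX' v) (XX' v vc)).
have GYY v S : measurable S -> GY v S ->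
    beta * fine (P S) <= \int[P]_(w in S) Y' v w.
  move=> mS GS; have [_ [Z [cZ Zbeta]]] := hv v.
  apply: (cond_exp_ge cZ (mY v) (bY' v) (YY' v)) => //.
  by move: Zbeta; apply: filterS => w ->.
have Dsub v (F : set (T -> R)) : v \in c ->
    (forall j, j \in c -> j != v -> F (X j) /\ F (Y j)) ->
    sigma_of [set D j | j in [set j | j \in c /\ j != v]] `<=` sigma_of F.
  move=> vc hF; apply: sigma_of_comp => _ [j [jc jv] <-].
  have [FX FY] := hF j jc jv.
  by apply: measurable_funB; apply: measurable_clamp;
    exact: measurable_fun_sigma_of.
(* Distinct vertices of the cycle leave along distinct edges, so the weight of the edge out of [v]
   enters no other term. *)
have DX v : v \in c ->
    sigma_of [set D j | j in [set j | j \in c /\ j != v]] `<=` GX v.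
  move=> vc; apply: Dsub => // j jc jv; split; last by left; exists j.
  right; exists (j, next c j) => //; split; first exact: cE.
  by apply: contra jv => /eqP[->].
have DY v : v \in c ->
    sigma_of [set D j | j in [set j | j \in c /\ j != v]] `<=` GY v.
  move=> vc; apply: Dsub => // j jc jv; split; last by left; exists j.
  by right; exists (j, next c j) => //; exact: cE.
(* Integrating over the whole space; together with [beta < B] this yields [beta - alpha < A + B], as
   [concentration] requires. *)
have alphaA : - A <= alpha.
  have [v vc] : exists v, v \in c.
    by case: (c) c0 => // v s _; exists v; rewrite mem_head.
  have GT : GX v setT.
    by rewrite -[setT](preimage_setT (Y v)); apply: sigma_of_preimage => //; left; exists v.
  have := GXX v _ vc measurableT GT.
  have -> : fine (P [set: T]) = 1 by rewrite probability_setT.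
  rewrite mulr1; apply: le_trans.
  rewrite -[leLHS](Rintegral_cst_probability P); apply: le_Rintegral => //.
  - exact/bounded_mfun_integrable/bounded_mfun_cst.
  - exact: bounded_mfun_integrable.
  - by move=> w _; have /andP[] := clamp_itv (X v w) AA.
have -> : ((alpha - beta) / (A + B)) ^+ 2 = ((beta - alpha) / (A + B)) ^+ 2.
  by rewrite -opprB mulNr sqrrN.
have conc := @concentration _ _ _ P _ D (A + B) (beta - alpha) _ _ _ c uc
  (fun v _ => mD v) (fun v _ => hD v).
apply: le_trans (conc _ _ _ _); last 4 first.
- by rewrite addr_gt0.
- by rewrite subr_ge0 ltW.
- lra.
- move=> v vc S GS.
  have mS : measurable S.
    move: GS; apply: sub_sigma_of_measurable => _ [j _ <-]; exact: mD.
  rewrite RintegralB//; last 2 first.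
  - exact: bounded_mfun_integrable.
  - exact: bounded_mfun_integrable.
  have h1 := GXX v S vc mS (DX v vc S GS).
  have h2 := GYY v S mS (DY v vc S GS).
  by rewrite opprB mulrBl lerB.
have msum (F : 'I_N -> T -> R) : (forall v, measurable_fun setT (F v)) ->
    measurable [set w | 0 <= \sum_(v <- c) F v w].
  move=> mF; have mS : measurable_fun setT (fun w => \sum_(v <- c) F v w).
    exact: measurable_sum.
  have := mS measurableT [set` `[0, +oo[] (measurable_itv _).
  rewrite setTI; congr (measurable _); apply/seteqP; split=> w /=;
    by rewrite in_itv /= andbT.
(* The tail bound concerns clamped terms, which almost surely agree with the true weights for all
   [v] in [c] simultaneously. *)
apply: le_probability_ae.
- apply: msum => v; apply: measurable_funB; first exact: mwe.
  exact: measurableT_comp.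
- exact: msum.
have : {ae P, forall w, forall v, v \in c -> D v w = X v w - `|wv v w|}.
  apply: filter_forall => v; have [vc|_] := boolP (v \in c); last first.
    by apply: aeW.
  move: (YY' v); apply: filterS2 (XX' v vc) => w hX hY _.
  by rewrite /D hX hY /Y /abs_scaled mulr1.
apply: filterS => w DE; congr (0 <= _).
by rewrite /cycle_weight big_seq [RHS]big_seq; apply: eq_bigr => v /DE.
Qed.

End cycle_weight.

(** * The randomly chosen cycle *)

Section independent_choice.
Context {R : realType} {disp : measure_display} {T : measurableType disp}.
Variable P : probability T R.

(** The space is partitioned by the value of [run]. By independence each piece of positive
    probability keeps at least the fraction [q]; summing gives the bound. Walks of probability 0 are
    excluded from the event at no cost. *)
Lemma countable_mixture_prob_ge {S : countType} (run : T -> S)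
  (Good : S -> set T) (q : R) : 0 <= q ->
  (forall s, measurable [set w | run w = s]) ->
  (forall s, P [set w | run w = s] != 0 ->
    [/\ measurable (Good s), (q%:E <= P (Good s))%E
      & P ([set w | run w = s] `&` Good s) =
        (P [set w | run w = s] * P (Good s))%E]) ->
  holds_with_prob_at_least P
    [set w | P [set w0 | run w0 = run w] != 0 /\ Good (run w) w] q.
Proof.
move=> q0 mrun hG; set F := [set w | _].
(* Codes index the partition by naturals; a code that is not attained gives an empty piece. *)
pose A k := [set w | pickle (run w) = k].
have FA k : (measurable (A k) /\ measurable (F `&` A k)) /\
    (q%:E * P (A k) <= P (F `&` A k))%E.
  have [[s sk]|nk] := pselect (exists s : S, pickle s = k); last first.
    have -> : A k = set0.
      by rewrite -subset0 => w wk; apply: nk; exists (run w).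
    by rewrite setI0 measure0 mule0; split.
  have -> : A k = [set w | run w = s].
    apply/seteqP; split=> w /=; rewrite /A /= -sk; last by move->.
    exact: (pcan_inj pickleK).
  have [P0|P0] := eqVneq (P [set w | run w = s]) 0.
    have -> : F `&` [set w | run w = s] = set0.
      by rewrite -subset0 => w [[+ _] ws]; rewrite ws P0 eqxx.
    by rewrite P0 mule0 measure0; split.
  have [mG qG indep] := hG s P0.
  have -> : F `&` [set w | run w = s] = [set w | run w = s] `&` Good s.
    apply/seteqP; split=> w.
      by move=> [[_ Gw] ws]; split => //; rewrite -ws.
    by move=> [ws Gw]; split=> //; rewrite /F /= ws.
  split; first by split=> //; exact: measurableI.
  by rewrite indep muleC lee_wpmul2l.
have AT : \bigcup_k A k = setT.
  by rewrite -subTset => w _; exists (pickle (run w)).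
have tA : trivIset setT A by move=> i j _ _ [w [<- <-]].
have tF : trivIset setT (fun k => F `&` A k).
  by move=> i j _ _ [w [[_ <-] [_ <-]]].
have FE : F = \bigcup_k (F `&` A k) by rewrite -setI_bigcupr AT setIT.
have mF : measurable F.
  by rewrite FE; apply: bigcup_measurable => k _; have [[]] := FA k.
exists F; split=> //.
rewrite FE measure_bigcup//; last by move=> k _; have [[]] := FA k.
have PT : (\sum_(0 <= k <oo | k \in setT) P (A k) = 1)%E.
  rewrite -measure_bigcup//; last by move=> k _; have [[]] := FA k.
  by rewrite AT; exact: probability_setT.
rewrite -[leLHS]mule1 -PT -nneseriesZl//.
by apply: lee_nneseries => k _; [rewrite mule_ge0|have [] := FA k].
Qed.

End independent_choice.

Unset Implicit Arguments.
Set Strict Implicit.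

Theorem proposition5
  (R : realType) (disp : measure_display) (T : measurableType disp)
  (P : probability T R)
  (N d m p : nat)
  (f : T -> 'I_N -> 'cV[R]_d -> 'cV[R]_m -> 'cV[R]_d)
  (h : T -> 'I_N -> 'cV[R]_d -> 'cV[R]_p)
  (PS PU : {set 'I_N}) (E : {set 'I_N * 'I_N}) (Dm DM : nat)
  (lam : 'I_N -> {RV P >-> R}) (mu : 'I_N -> 'I_N -> {RV P >-> R})
  (hpart : PS :|: PU = [set: 'I_N]%SET /\ PS :&: PU = finset.set0)
  (hIOSS : forall w i, i \in PS -> IOSS (f w) (h w) (fun=> i))
  (hunst : forall w i, i \in PU -> ~ IOSS (f w) (h w) (fun=> i))
  (hE : forall i j, (i, j) \in E -> i != j)
  (hker : forall w i xi, f w i xi 0 = 0 <-> xi = 0)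
  (hlyap : forall w, lyapunov_assumptions (f w) (h w) PS E
             (fun i => lam i w) (fun i j => mu i j w))
  (A_ : T -> 'I_N -> 'M[R]_d)
  (hlin : forall w i xi eta, f w i xi eta = A_ w i *m xi)
  (hout : forall w i xi, h w i xi = 0)
  (hDm : Dm = 1%N)
  (Phi : nat -> R) (hPhi : monotone_increasing Phi)
  (hconn : nicely_connected PS E Phi)
  (beta B A alpha : R)
  (hweight : nicely_weighted_with P E
     (vweight PS (fun i => lam i)) (eweight (fun i j => mu i j))
     Dm DM 1 beta B A alpha)
  (run : T -> seq 'I_N)
  (hrun : cycle_detection_run P E
     (vweight PS (fun i => lam i)) (eweight (fun i j => mu i j)) PS run)
  (sigma : T -> nat -> 'I_N)
  (hsigma : forall w,
     switching_construction 1 (cycle_of_run PS E (run w)) (sigma w)) :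
  holds_with_prob_at_least P [set w | GAS (f w) (sigma w)]
    (1 - expR (- (2^-1 * ((alpha - beta) / (A + B)) ^+ 2
                  * (Num.floor (Phi #|PS|))%:~R))).
Proof.
set M := Num.floor (Phi #|PS|); set k := 2^-1 * _.
have k0 : 0 <= k by rewrite mulr_ge0 ?sqr_ge0.
(* For [M <= 0] the claimed bound is at most 0 and the empty event suffices; for [M > 0] every
   vertex has an out-neighbour in [PS], so the walk closes to a cycle. *)
have [M0|M0] := leP M 0.
  exists set0; split=> //; rewrite measure0 lee_fin subr_le0 -[leLHS]expR0 ler_expR.
  by rewrite oppr_ge0 mulr_ge0_le0// lerz0.
set wv := vweight _ _ in hweight hrun; set we := eweight _ in hweight hrun.
have mln (X : {RV P >-> R}) : measurable_fun setT (fun w => ln (X w)).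
  exact: measurableT_comp.
have mwv v : measurable_fun setT (wv v).
  have mabs : measurable_fun setT (fun w => `|ln (lam v w)|).
    exact: measurableT_comp.
  rewrite /wv /vweight; case: (v \in PS) => //.
  exact: measurableT_comp.
have mwe e : measurable_fun setT (we e) by exact: mln.
pose q := 1 - expR (- (k * M%:~R)).
have q0 : 0 <= q.
  by rewrite subr_ge0 -[leRHS]expR0 ler_expR oppr_le0 mulr_ge0// ler0z ltW.
have card_gt v : M <= #|Nplus PS E v|%:Z by exact: hconn.
have hN v : (0 < #|Nplus PS E v|)%N.
  by rewrite -ltz_nat; exact: lt_le_trans (card_gt v).
have cycP s : P [set w | run w = s] != 0 ->
    let c := cycle_of_run PS E s in
    [/\ uniq c, cycle (fun u w => w \in Nplus PS E u) c, (0 < size c)%N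
      & M <= (size c)%:Z].
  have [_ -> _] := hrun s; rewrite eqe => Ps c.
  have [uc cyc [v vc]] := cycle_of_run_cycle hE hN Ps.
  split=> //; first exact: leq_trans vc.
  by apply: le_trans (card_gt v) _; rewrite lez_nat ltnW.
(* For a fixed walk [s] this is an event about the weights alone, as the independence of [run]
   demands. *)
pose Good s := cycle_weight wv we (cycle_of_run PS E s) @^-1` [set` `]-oo, 0[].
have cE s : P [set w | run w = s] != 0 -> forall v,
    v \in cycle_of_run PS E s -> (v, next (cycle_of_run PS E s) v) \in E.
  move=> /cycP[_ cyc _ _] v vc.
  by have := next_cycle cyc vc; rewrite inE => /andP[].
have sG s : P [set w | run w = s] != 0 -> sigma_weights E wv we (Good s).
  by move=> Ps; apply: sigma_weights_cycle_weight (cE s Ps) _.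
have [s|s Ps|F [mF Fsub qF]] := @countable_mixture_prob_ge _ _ _ P _ run Good q q0.
- by have [] := hrun s.
- have [uc cyc c0 Mc] := cycP s Ps; have [_ _ indep] := hrun s.
  have mG : measurable (Good s).
    apply: sub_sigma_of_measurable (sG s Ps) => _ [[v _ <-]|[e _ <-]] //.
  split=> //; last exact: indep (sG s Ps).
  rewrite -[Good s]setCK probability_setC; last exact: measurableC.
  have := cycle_weight_tail mwv mwe hweight uc c0 (cE s Ps).
  have -> : [set w | 0 <= cycle_weight wv we (cycle_of_run PS E s) w] = ~` Good s.
    apply/seteqP; split=> w; rewrite /Good /= in_itv /=.
      by rewrite leNgt => /negP.
    by move/negP; rewrite -leNgt.
  (* The exponent of the tail contains the cycle length, which is at least [M]. *)
  move=> tail; rewrite /q EFinB leeB//; apply: le_trans tail _.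
  rewrite lee_fin ler_expR lerN2 ler_wpM2l//.
  by rewrite -[leRHS]/((size _)%:Z%:~R) ler_int.
exists F; split=> // w /Fsub [Pw].
rewrite /Good /= in_itv /= => neg; have [uc cyc c0 _] := cycP _ Pw.
apply: (cycle_GAS (hlyap w) (hlin w) (hout w) uc c0 cyc (hsigma w)).
rewrite (eq_bigr _ (_ : forall v, _ -> _ =
  we (v, next (cycle_of_run PS E (run w)) v) w - `|wv v w|))// => v _.
by rewrite /wv /vweight; case: (v \in PS); rewrite ?normrN normr_id.
Qed.
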